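(* Let $A$ be an $N\times N$ real symmetric matrix with eigenvalues $\lambda_1\le\cdots\le\lambda_N$, and let $\{q_1,\dots,q_N\}$ be an orthonormal basis of $\mathbb{R}^N$ with $Aq_i=\lambda_iq_i$ for each $i$. Let $\gamma>\max(0,-\lambda_1)$ and let $0<\alpha<\frac{1}{\lambda_N+\gamma}$. Let $x_0=\mu_{0,1}q_1+\cdots+\mu_{0,N}q_N\neq0$ and define $\{x_k\}$ by $$x_{k+1}=x_k-\alpha\nabla F_A(x_k)=x_k-\alpha\Big(Ax_k+\gamma x_k-\frac{\gamma}{\|x_k\|}x_k\Big),\qquad k=0,1,2,\dots$$ Let $l=\min\{j\in\{1,\dots,N\}:\mu_{0,j}\neq0\}$. Then $\{x_k\}$ converges to a critical point $x_*$ of $F_A$, which is an eigenvector of $A$ corresponding to the eigenvalue $\lambda_l$ with $\|x_*\|=\frac{\gamma}{\gamma+\lambda_l}$. More precisely, $$x_*=\Big(\frac{\gamma}{\gamma+\lambda_l}\Big)\Big(\frac{1}{\sqrt{\sum_{m:\lambda_m=\lambda_l}\mu_{0,m}^2}}\Big)\sum_{m:\lambda_m=\lambda_l}\mu_{0,m}q_m.$$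
   Context: $F_A:\mathbb{R}^N\to\mathbb{R}$ is $F_A(x)=\frac12\langle x,Ax\rangle+\frac{\gamma}{2}\|x\|^2-\gamma\|x\|$, with the Euclidean inner product and norm. It is differentiable at $x\ne0$; a (nonzero) critical point is a point $x\ne 0$ with $\nabla F_A(x)=0$. *)

(* Defs.v *)
From HB Require Import structures.
From mathcomp Require Export all_boot all_order all_algebra.
From mathcomp Require Export all_classical all_reals all_analysis.
Export Order.TTheory GRing.Theory Num.Theory.
Export numFieldNormedType.Exports.

Set Implicit Arguments.
Unset Strict Implicit.
Unset Printing Implicit Defensive.

Local Open Scope classical_set_scope.
Local Open Scope ring_scope.

Definition dotv (R : realType) (n : nat) (u v : 'cV[R]_n) : R :=
  \sum_(i < n) u i 0 * v i 0.

(* The library norm `|x| on matrices is the sup norm, which induces the same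
   topology as this one. *)
Definition enorm (R : realType) (n : nat) (x : 'cV[R]_n) : R :=
  Num.sqrt (dotv x x).

Definition orthonormal_basis (R : realType) (n : nat)
    (q : 'I_n -> 'cV[R]_n) : Prop :=
  basis_of fullv (codom q) /\
  forall i j, dotv (q i) (q j) = (i == j)%:R.

(* Vector of partial derivatives; it represents the differential of f only at
   points where f is differentiable. *)
Definition gradient (R : realType) (n : nat) (f : 'cV[R]_n -> R)
    (x : 'cV[R]_n) : 'cV[R]_n :=
  \col_(i < n) 'D_(delta_mx i 0) f x.

Definition critical_point (R : realType) (n : nat) (f : 'cV[R]_n -> R)
    (x : 'cV[R]_n) : Prop :=
  [/\ x != 0, differentiable f x & gradient f x = 0].

Definition FA (R : realType) (n : nat) (A : 'M[R]_n) (gamma : R)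
    (x : 'cV[R]_n) : R :=
  2^-1 * dotv x (A *m x) + gamma / 2 * enorm x ^+ 2 - gamma * enorm x.

(* Main.v *)
From HB Require Import structures.
From mathcomp Require Import ring lra.
Require Import Defs.

Set Implicit Arguments.
Unset Strict Implicit.
Unset Printing Implicit Defensive.

Local Open Scope classical_set_scope.
Local Open Scope ring_scope.

(** Write x k in the eigenbasis. One gradient step multiplies the i-th
    coordinate by
      c k i = 1 - alpha * (lambda i + gamma) + alpha * gamma / enorm (x k),
    and the bounds on gamma and alpha put 1 - alpha * (lambda i + gamma)
    strictly between 0 and 1. So every factor is positive, signs are kept, the
    l-th coordinate never vanishes, and no iterate is 0 (iterE, iter_neq0).

    The smaller the eigenvalue, the larger the factor, as in the power method.
    Let P k be the product of the first k factors at index l. Dividing by P k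
    leaves the coordinates of the eigenspace of lambda l unchanged, and makes
    the others decay geometrically; the decay is uniform because the norms of
    the iterates are bounded below by alpha * gamma (iter_norm_ge, ratio_cvg).
    Hence x k / P k converges to the projection v of x 0 on that eigenspace
    (direction_cvg).

    It remains to find the limit of the scale P k. With
    s = 1 - alpha * (lambda l + gamma), it satisfies
      P k.+1 = s * P k + alpha * gamma / enorm (x k / P k),
    an affine contraction whose forcing term converges to
    alpha * gamma / enorm v; so P k converges to
    gamma / (gamma + lambda l) / enorm v (affine_recursion_cvg, scale_cvg).
    Multiplying the two limits gives that of x k. It is an eigenvector of norm
    gamma / (gamma + lambda l), which is exactly the norm at which the gradient
    (gradient_FA) of an eigenvector for lambda l vanishes. *)

(** * Euclidean inner product *)

Section DotProduct.
Context {R : realType} {n : nat}.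
Implicit Types (u v w : 'cV[R]_n) (A : 'M[R]_n) (a : R).

Lemma dotvE u v : dotv u v = (u^T *m v) 0 0.
Proof. by rewrite !mxE; apply: eq_bigr => i _; rewrite mxE. Qed.

Lemma dotvC u v : dotv u v = dotv v u.
Proof. by apply: eq_bigr => i _; rewrite mulrC. Qed.

Lemma dotvDr u v w : dotv u (v + w) = dotv u v + dotv u w.
Proof. by rewrite !dotvE mulmxDr mxE. Qed.

Lemma dotvZr a u v : dotv u (a *: v) = a * dotv u v.
Proof. by rewrite !dotvE -scalemxAr mxE. Qed.

Lemma dotv_sumr (I : finType) (P : pred I) u (f : I -> 'cV[R]_n) :
  dotv u (\sum_(i | P i) f i) = \sum_(i | P i) dotv u (f i).
Proof.
rewrite dotvE mulmx_sumr summxE; apply: eq_bigr => i _; exact/esym/dotvE.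
Qed.

Lemma dotv_mulmxC A u v : A^T = A -> dotv (A *m u) v = dotv u (A *m v).
Proof. by move=> hA; rewrite !dotvE trmx_mul hA mulmxA. Qed.

Lemma dotv_delta u i : dotv u (delta_mx i 0) = u i 0.
Proof.
rewrite /dotv (bigD1 i)//= big1 => [|j ji]; rewrite !mxE ?eqxx ?(negPf ji)/=.
  by rewrite mulr1 addr0.
by rewrite mulr0.
Qed.

Lemma dotvv_ge0 u : 0 <= dotv u u.
Proof. by apply: sumr_ge0 => i _; rewrite -expr2 sqr_ge0. Qed.

Lemma dotvv_gt0 u : u != 0 -> 0 < dotv u u.
Proof.
rewrite lt_def dotvv_ge0 andbT; apply: contra_neq => /eqP.
rewrite psumr_eq0 => [/allP h|i _]; last by rewrite -expr2 sqr_ge0.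
apply/matrixP => i j; rewrite ord1 mxE; apply/eqP.
by have := h i (mem_index_enum _); rewrite mulf_eq0 orbb.
Qed.

Lemma enorm_gt0 u : u != 0 -> 0 < enorm u.
Proof. by move=> u0; rewrite sqrtr_gt0 dotvv_gt0. Qed.

Lemma enorm_sqr u : enorm u ^+ 2 = dotv u u.
Proof. by rewrite sqr_sqrtr// dotvv_ge0. Qed.

Lemma enormZ a u : enorm (a *: u) = `|a| * enorm u.
Proof.
by rewrite /enorm dotvZr dotvC dotvZr mulrA -expr2 sqrtrM ?sqr_ge0// sqrtr_sqr.
Qed.

End DotProduct.

Section Orthonormal.
Context {R : realType} {n : nat} {q : 'I_n -> 'cV[R]_n}.
Hypothesis hq : orthonormal_basis q.

Lemma dotv_basis (a : 'I_n -> R) j : dotv (q j) (\sum_i a i *: q i) = a j.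
Proof.
rewrite dotv_sumr (bigD1 j)//= big1 => [|i ij]; rewrite dotvZr hq.2.
  by rewrite eqxx mulr1 addr0.
by rewrite eq_sym (negPf ij) mulr0.
Qed.

Lemma dotvv_basis (a : 'I_n -> R) :
  dotv (\sum_i a i *: q i) (\sum_i a i *: q i) = \sum_i a i ^+ 2.
Proof.
rewrite [LHS]dotv_sumr; apply: eq_bigr => i _.
by rewrite dotvZr dotvC dotv_basis expr2.
Qed.

Lemma basis_comb_neq0 (a : 'I_n -> R) j : a j != 0 -> \sum_i a i *: q i != 0.
Proof.
apply: contra_neq => h; have := dotv_basis a j; rewrite h => <-.
by rewrite -[0](scale0r 0) dotvZr mul0r.
Qed.

End Orthonormal.

(** * Differential of the objective *)

Section Gradient.
Context {R : realType} {n : nat}.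
Implicit Types (x : 'cV[R]_n.+1) (A : 'M[R]_n.+1) (gamma : R).

Lemma is_diff_sum (V : normedModType R) m (f df : 'I_m -> V -> R) (x : V) :
  (forall i, is_diff x (f i) (df i)) ->
  is_diff x (fun y => \sum_i f i y) (fun v => \sum_i df i v).
Proof.
move=> h.
have -> : (fun y => \sum_i f i y) = \sum_i f i.
  by apply/funext => y; rewrite fct_sumE.
have -> : (fun y => \sum_i df i y) = \sum_i df i.
  by apply/funext => y; rewrite fct_sumE.
apply: (big_ind2 (fun g dg => is_diff x g dg)) => //; first exact: is_diff_cst.
by move=> *; exact: is_diffD.
Qed.

Lemma is_diff_coord x i :
  is_diff x (fun y => y i 0 : R) (fun v => v i 0).
Proof.
have lin : linear (fun y : 'cV[R]_n.+1 => y i 0 : R).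
  by move=> a u v; rewrite !mxE.
pose L : {linear 'cV[R]_n.+1 -> R} := HB.pack (fun y : 'cV[R]_n.+1 => y i 0 : R)
  (GRing.isLinear.Build _ _ _ _ _ lin).
have cL : continuous L by exact: coord_continuous.
change (is_diff x L L); apply: DiffDef; first exact: linear_differentiable.
by rewrite diff_lin.
Qed.

(** The differential of a quadratic form carries both A and its transpose;
    symmetry merges the two contributions. With A the identity this also
    gives the squared norm. *)
Lemma is_diff_quadratic A x : A^T = A ->
  is_diff x (fun y => dotv y (A *m y)) (fun v => 2 * dotv (A *m x) v).
Proof.
move=> hA.
have dA i : is_diff x (fun y => (A *m y) i 0 : R) (fun v => (A *m v) i 0).
  have -> : (fun y => (A *m y) i 0 : R) =
      fun y : 'cV_n.+1 => \sum_j A i j * y j 0.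
    by apply/funext => y; rewrite mxE.
  apply: is_diff_eq; first apply: is_diff_sum => j.
    by apply: is_diffZ; exact: is_diff_coord.
  by [].
apply: is_diff_eq; first apply: is_diff_sum => i.
  exact: is_diffM (is_diff_coord x i) (dA i).
apply/funext => v; rewrite big_split/= mulr_natl mulr2n; congr (_ + _).
by rewrite (dotv_mulmxC _ _ hA).
Qed.

(** Chain rule for the square root of the quadratic form of the identity,
    whose argument is positive away from the origin. It also provides the
    continuity of the Euclidean norm for the topology of the sup norm. *)
Lemma is_diff_enorm x : x != 0 ->
  is_diff x (@enorm R n.+1) (fun v => (enorm x)^-1 * dotv x v).
Proof.
move=> x0.
have dq : is_diff x (fun y => dotv y y) (fun v => 2 * dotv x v).
  have := @is_diff_quadratic 1%:M x (trmx1 _ _).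
  by under eq_fun do rewrite mul1mx; rewrite mul1mx.
have dx0 := dotvv_gt0 x0.
have ds : is_diff (dotv x x) Num.sqrt (fun h => (2 * enorm x)^-1 * h).
  have [ds1 ds2] := is_derive1_sqrt dx0.
  apply: DiffDef; first exact/derivable1_diffP.
  by apply/funext => h; rewrite deriv1E // derive1E ds2; exact: mulrC.
have d := is_diff_comp dq ds; apply: (is_diff_eq d).
apply/funext => v /=; have := enorm_gt0 x0; move: (enorm x) => e e0.
by field; rewrite gt_eqF.
Qed.

Lemma is_diff_FA A gamma x : A^T = A -> x != 0 ->
  is_diff x (FA A gamma)
    (dotv (A *m x + gamma *: x - (gamma / enorm x) *: x)).
Proof.
move=> hA x0.
have d1 := is_diff_quadratic x hA.
have d2 := is_diff_enorm x0.
have d := is_diffB (is_diffD (is_diffZ 2^-1 d1)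
  (is_diffZ (gamma / 2) (is_diffX 1 d2))) (is_diffZ gamma d2).
apply: (is_diff_eq d).
apply/funext => v.
rewrite -[in RHS]scaleNr [RHS]dotvC !dotvDr !dotvZr !(dotvC v).
have := enorm_gt0 x0; move: (enorm x) => e e0.
rewrite !fctE /GRing.scale/=; field.
by rewrite gt_eqF.
Qed.

Lemma gradient_FA A gamma x : A^T = A -> x != 0 ->
  gradient (FA A gamma) x = A *m x + gamma *: x - (gamma / enorm x) *: x.
Proof.
move=> hA x0; have [df dFA] := is_diff_FA gamma hA x0.
apply/matrixP => i j; rewrite ord1 mxE deriveE// dFA.
exact: dotv_delta.
Qed.

End Gradient.

(** * Two scalar recursions *)

Section Recursions.
Context {R : realType}.

Lemma contraction_cvg0 (th : R) (u : nat -> R) : 0 <= th < 1 ->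
  (forall k, `|u k.+1| <= th * `|u k|) -> u k @[k --> \oo] --> 0.
Proof.
move=> /andP[th0 th1] hu; apply: norm_cvg0.
have ub k : `|u k| <= `|u 0%N| * th ^+ k.
  elim: k => [|k IH]; first by rewrite expr0 mulr1.
  by rewrite (le_trans (hu k))// exprS mulrCA ler_wpM2l.
apply: (@squeeze_cvgr _ _ _ _ (fun=> 0) (geometric `|u 0%N| th)).
- by apply: nearW => k; rewrite normr_ge0 ub.
- exact: cvg_cst.
- by apply: cvg_geometric; rewrite ger0_norm.
Qed.

(** The error e k = L - y k to the fixed point L = s * L + c satisfies
    e k.+1 = s * e k + (c - w k): once the forcing term is below
    eps / 2 * (1 - s), an error bound of the form a * s ^+ m + eps / 2
    reproduces itself at each step. *)
Lemma affine_recursion_cvg (s c : R) (y w : nat -> R) : 0 <= s < 1 ->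
  (forall k, y k.+1 = s * y k + w k) -> w k @[k --> \oo] --> c ->
  y k @[k --> \oo] --> c / (1 - s).
Proof.
move=> /andP[s0 s1] hy hw; have s1' : 0 < 1 - s by rewrite subr_gt0.
set L := c / (1 - s).
have Lfix : L = s * L + c by rewrite /L; field; rewrite gt_eqF.
apply/cvgrPdist_le => e e0.
have e1 : 0 < e / 2 * (1 - s) by rewrite mulr_gt0// divr_gt0.
have [N _ hN] := (cvgrPdist_le _ _).1 hw _ e1.
have ub m : `|L - y (m + N)%N| <= `|L - y N| * s ^+ m + e / 2.
  elim: m => [|m IH]; first by rewrite expr0 mulr1 lerDl divr_ge0// ltW.
  rewrite addSn hy {1}Lfix.
  rewrite (_ : _ - _ = s * (L - y (m + N)%N) + (c - w (m + N)%N)); last by ring.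
  rewrite (le_trans (ler_normD _ _))// normrM ger0_norm//.
  have := hN (m + N)%N (leq_addl _ _); have := ler_wpM2l s0 IH.
  by rewrite exprS /=; lra.
have /cvgrPdist_le/(_ (e / 2)) : geometric `|L - y N| s k @[k --> \oo] --> 0.
  by apply: cvg_geometric; rewrite ger0_norm.
case=> [|M _ hM]; first by rewrite divr_gt0.
(* N steps for the forcing term to settle, then M to damp the error at N. *)
exists (M + N)%N => // k /= hk.
have kE : k = (k - N + N)%N by rewrite subnK// (leq_trans _ hk)// leq_addl.
have MkN : (M <= k - N)%N by rewrite -(leq_add2r N) -kE.
have := hM _ MkN; rewrite /= sub0r normrN => h.
rewrite kE; have := ub (k - N)%N; have := ler_norm (`|L - y N| * s ^+ (k - N)).
lra.
Qed.

End Recursions.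

(** * Gradient descent in the eigenbasis *)

Section Dynamics.
Context {R : realType} {n : nat}.
Variables (A : 'M[R]_n.+1) (lambda : 'I_n.+1 -> R) (q : 'I_n.+1 -> 'cV[R]_n.+1).
Variables (gamma alpha : R) (mu : 'I_n.+1 -> R) (x : nat -> 'cV[R]_n.+1).
Hypothesis hq : orthonormal_basis q.
Hypothesis hAq : forall i, A *m q i = lambda i *: q i.
Hypotheses (gamma_gt0 : 0 < gamma) (alpha_gt0 : 0 < alpha).
Let s i := 1 - alpha * (lambda i + gamma).
Hypothesis s01 : forall i, 0 < s i < 1.
Hypothesis hx0 : x 0%N = \sum_i mu i *: q i.
Hypothesis hx : forall k, x k != 0 -> x k.+1 = x k - alpha *:
  (A *m x k + gamma *: x k - (gamma / enorm (x k)) *: x k).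
Variable l : 'I_n.+1.
Hypothesis hl : mu l != 0.
Hypothesis hl_min : forall i, mu i != 0 -> lambda l <= lambda i.

(** The factor by which step k multiplies the i-th coordinate. *)
Let c k i := s i + alpha * gamma / enorm (x k).
Let coord k i := mu i * \prod_(j < k) c j i.

Lemma factor_ge k i : alpha * gamma / enorm (x k) <= c k i.
Proof. by rewrite lerDr; case/andP: (s01 i) => /ltW. Qed.

Lemma factor_gt0 k i : 0 < c k i.
Proof.
rewrite ltr_pwDl//; first by case/andP: (s01 i).
by rewrite divr_ge0 ?sqrtr_ge0// mulr_ge0// ltW.
Qed.

Lemma scale_gt0 k i : 0 < \prod_(j < k) c j i.
Proof. by apply: prodr_gt0 => j _; exact: factor_gt0. Qed.

Lemma coord_l_neq0 k : coord k l != 0.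
Proof. by rewrite mulf_neq0// gt_eqF// scale_gt0. Qed.

(** Since A, the identity and the rescaling by the norm are all diagonal in
    the eigenbasis, a step acts separately on each coordinate. The formula
    for the step requires a nonzero iterate; this is available along the
    induction because the l-th coordinate is a product of positive factors
    and mu l. *)
Lemma iterE k : x k = \sum_i coord k i *: q i.
Proof.
elim: k => [|k IH].
  by rewrite hx0; apply: eq_bigr => i _; rewrite /coord big_ord0 mulr1.
have xk0 : x k != 0 by rewrite IH; exact/(basis_comb_neq0 hq)/coord_l_neq0.
rewrite hx// {1 2 3 5}IH mulmx_sumr !scaler_sumr -big_split/=.
rewrite -sumrB scaler_sumr -sumrB.
apply: eq_bigr => i _; rewrite -scalemxAr hAq !scalerA -scalerDl -scalerBl.
rewrite scalerA -scalerBl; congr (_ *: _).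
by rewrite /coord big_ord_recr/= /c /s; ring.
Qed.

Lemma iter_neq0 k : x k != 0.
Proof. by rewrite iterE; exact/(basis_comb_neq0 hq)/coord_l_neq0. Qed.

(** Every coordinate of x k is multiplied by at least
    alpha * gamma / enorm (x k), hence so is the norm: one step suffices to
    leave the ball of radius alpha * gamma. This bounds the factors c k i
    by 2 from the second iterate on. *)
Lemma iter_norm_ge k : alpha * gamma <= enorm (x k.+1).
Proof.
have xk0 := enorm_gt0 (iter_neq0 k).
set t := alpha * gamma / enorm (x k).
have t0 : 0 < t by rewrite divr_gt0// mulr_gt0.
rewrite -(@divfK _ (enorm (x k)) _ (alpha * gamma)) ?gt_eqF// -/t.
rewrite -ler_sqr ?nnegrE ?sqrtr_ge0//; last exact/ltW/mulr_gt0.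
rewrite exprMn !enorm_sqr !iterE !(dotvv_basis hq) mulr_sumr.
apply: ler_sum => i _.
have -> : coord k.+1 i = c k i * coord k i.
  by rewrite /coord big_ord_recr/= [RHS]mulrC mulrA.
rewrite [in leRHS]exprMn ler_wpM2r ?sqr_ge0// ler_sqr ?nnegrE.
- exact: factor_ge.
- exact: ltW.
- exact/ltW/factor_gt0.
Qed.

(** The common factor, over k steps, of the coordinates in the eigenspace of
    lambda l. *)
Let P k := \prod_(j < k) c j l.

(** Inside the eigenspace of lambda l all factors agree. Elsewhere a nonzero
    coordinate has a larger eigenvalue, so that
    c k i / c k l = 1 - alpha * (lambda i - lambda l) / c k l, and the bound
    c k l <= 2 keeps this quotient uniformly below 1. *)
Lemma ratio_cvg i : coord k i / P k @[k --> \oo] -->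
  (if lambda i == lambda l then mu i else 0).
Proof.
case: ifPn => [/eqP li|li].
  rewrite (_ : (fun k => _) = fun=> mu i); first exact: cvg_cst.
  apply/funext => k; rewrite -mulrA (_ : P k = \prod_(j < k) c j i).
    by rewrite divff ?mulr1// gt_eqF// scale_gt0.
  by apply: eq_bigr => j _; rewrite /c /s li.
have [mi|mi] := eqVneq (mu i) 0.
  rewrite (_ : (fun k => _) = fun=> 0); first exact: cvg_cst.
  by apply/funext => k; rewrite /coord mi !mul0r.
have {mi li}lti : lambda l < lambda i by rewrite lt_neqAle eq_sym li hl_min.
(* The bound c k l <= 2 may fail at k = 0, as x 0 may be arbitrarily small. *)
rewrite -cvg_shiftS.
pose d := alpha * (lambda i - lambda l).
have d0 : 0 < d by rewrite mulr_gt0// subr_gt0.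
have /andP[si0 si1] := s01 i; have /andP[sl0 sl1] := s01 l.
have sE : s i = s l - d by rewrite /s /d; ring.
apply: (@contraction_cvg0 _ (1 - d / 2)); first by apply/andP; split; lra.
move=> k.
have cl0 := factor_gt0 k.+1 l.
have cl2 : c k.+1 l <= 2.
  have : alpha * gamma / enorm (x k.+1) <= 1.
    by rewrite ler_pdivrMr ?mul1r ?iter_norm_ge// enorm_gt0// iter_neq0.
  by rewrite /c; lra.
have -> : coord k.+2 i / P k.+2 =
    (c k.+1 i / c k.+1 l) * (coord k.+1 i / P k.+1).
  rewrite /coord /P ![\prod_(j < k.+2) _]big_ord_recr/=.
  by field; rewrite !gt_eqF ?factor_gt0// scale_gt0.
rewrite normrM ler_wpM2r// ger0_norm; last by rewrite divr_ge0 ?ltW ?factor_gt0.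
rewrite ler_pdivrMr// /c sE -/(c k.+1 l).
have : d / 2 * c k.+1 l <= d / 2 * 2 by rewrite ler_wpM2l// divr_ge0 ?ltW.
rewrite /c; lra.
Qed.

(** The projection of x 0 on the eigenspace of lambda l. *)
Let v := \sum_(i | lambda i == lambda l) mu i *: q i.

Lemma vE : v = \sum_i (if lambda i == lambda l then mu i else 0) *: q i.
Proof.
rewrite /v big_mkcond; apply: eq_bigr => i _.
by case: ifP => // _; rewrite scale0r.
Qed.

Lemma v_neq0 : v != 0.
Proof. by rewrite vE (basis_comb_neq0 hq (j := l))// eqxx. Qed.

Lemma enorm_v :
  enorm v = Num.sqrt (\sum_(i | lambda i == lambda l) mu i ^+ 2).
Proof.
rewrite /enorm vE (dotvv_basis hq) [in RHS]big_mkcond; congr Num.sqrt.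
by apply: eq_bigr => i _; case: ifP => // _; rewrite expr0n.
Qed.

Lemma mulmx_v : A *m v = lambda l *: v.
Proof.
rewrite mulmx_sumr scaler_sumr; apply: eq_bigr => i /eqP li.
by rewrite -scalemxAr hAq li !scalerA mulrC.
Qed.

Lemma direction_cvg : (P k)^-1 *: x k @[k --> \oo] --> v.
Proof.
rewrite vE.
have -> : (fun k => (P k)^-1 *: x k) =
    fun k => \sum_i (coord k i / P k) *: q i.
  apply/funext => k; rewrite iterE scaler_sumr; apply: eq_bigr => i _.
  by rewrite scalerA mulrC.
apply: cvg_big => [|i _]; first exact: add_continuous.
by apply: cvgZr_tmp; exact: ratio_cvg.
Qed.

(** P k.+1 = s l * P k + alpha * gamma * (P k / enorm (x k)), and the last
    quotient is the inverse of the norm of (P k)^-1 *: x k, which converges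
    by direction_cvg: this is an affine recursion with contraction s l < 1
    and convergent forcing term. *)
Lemma scale_cvg : P k @[k --> \oo] --> gamma / (gamma + lambda l) / enorm v.
Proof.
have v0 := enorm_gt0 v_neq0.
have /andP[sl0 sl1] := s01 l.
(* 1 - s l = alpha * (lambda l + gamma) *)
have gl0 : 0 < lambda l + gamma.
  by move: sl1; rewrite /s ltrBlDr ltrDl pmulr_rgt0.
have -> : gamma / (gamma + lambda l) / enorm v =
    alpha * gamma / enorm v / (1 - s l).
  rewrite /s; field; apply/and3P; split; rewrite gt_eqF//.
    by rewrite opprB addrC subrK mulr_gt0.
  by rewrite addrC.
apply: (@affine_recursion_cvg _ _ _ P
  (fun k => alpha * gamma / enorm ((P k)^-1 *: x k))).
- by rewrite ltW.
- move=> k; rewrite enormZ gtr0_norm ?invr_gt0 ?scale_gt0//.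
  rewrite [in LHS]/P big_ord_recr/= -/(P k) /c.
  by field; rewrite !gt_eqF ?scale_gt0// enorm_gt0// iter_neq0.
apply: cvgMl_tmp; apply: cvgV; first by rewrite gt_eqF.
apply: continuous_cvg direction_cvg.
have [dv _] := is_diff_enorm v_neq0.
exact: differentiable_continuous.
Qed.

Lemma iter_cvg :
  x k @[k --> \oo] --> (gamma / (gamma + lambda l) / enorm v) *: v.
Proof.
have -> : x = fun k => P k *: ((P k)^-1 *: x k).
  by apply/funext => k; rewrite scalerA divff ?scale1r// gt_eqF// scale_gt0.
exact: cvgZ scale_cvg direction_cvg.
Qed.

End Dynamics.

Theorem theorem2 (R : realType) (n : nat) (A : 'M[R]_n.+1)
    (lambda : 'I_n.+1 -> R) (q : 'I_n.+1 -> 'cV[R]_n.+1)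
    (gamma alpha : R) (mu : 'I_n.+1 -> R) (x : nat -> 'cV[R]_n.+1)
    (l : 'I_n.+1)
    (hA : A^T = A)
    (hlambda : forall i j : 'I_n.+1, (i <= j)%N -> lambda i <= lambda j)
    (hq : orthonormal_basis q)
    (hAq : forall i : 'I_n.+1, A *m q i = lambda i *: q i)
    (hgamma : Num.max 0 (- lambda ord0) < gamma)
    (halpha0 : 0 < alpha)
    (halpha : alpha < 1 / (lambda ord_max + gamma))
    (hx0 : x 0%N = \sum_(i < n.+1) mu i *: q i)
    (hx0_neq0 : x 0%N != 0)
    (hx : forall k : nat, x k.+1 = x k - alpha *: gradient (FA A gamma) (x k))
    (hl : mu l != 0)
    (hl_min : forall j : 'I_n.+1, mu j != 0 -> (l <= j)%N) :
  (forall k : nat, x k != 0 /\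
     x k.+1 = x k - alpha *:
       (A *m x k + gamma *: x k - (gamma / enorm (x k)) *: x k)) /\
  exists xstar : 'cV[R]_n.+1,
    [/\ x k @[k --> \oo] --> xstar,
        critical_point (FA A gamma) xstar,
        xstar != 0 /\ A *m xstar = lambda l *: xstar,
        enorm xstar = gamma / (gamma + lambda l) &
        xstar = (gamma / (gamma + lambda l)) *:
          ((1 / Num.sqrt (\sum_(m < n.+1 | lambda m == lambda l) mu m ^+ 2)) *:
           \sum_(m < n.+1 | lambda m == lambda l) mu m *: q m)].
Proof.
have glt : forall i, 0 < lambda i + gamma.
  move=> i; rewrite -ltrBlDl sub0r.
  have := hlambda ord0 i (leq0n _); move: hgamma; rewrite gt_max => /andP[_].
  lra.
have gamma0 : 0 < gamma by move: hgamma; rewrite gt_max => /andP[].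
have s01 i : 0 < 1 - alpha * (lambda i + gamma) < 1.
  rewrite subr_gt0 ltrBlDr ltrDl mulr_gt0// andbT.
  have : alpha * (lambda i + gamma) <= alpha * (lambda ord_max + gamma).
    by rewrite (ler_wpM2l (ltW halpha0))// lerD2r hlambda// -ltnS.
  by move/le_lt_trans; apply; rewrite -ltr_pdivlMr.
have hstep k : x k != 0 -> x k.+1 = x k - alpha *:
    (A *m x k + gamma *: x k - (gamma / enorm (x k)) *: x k).
  by move=> xk0; rewrite hx gradient_FA.
have lmin i : mu i != 0 -> lambda l <= lambda i.
  by move=> mi; apply: hlambda; exact: hl_min.
have x_neq0 := iter_neq0 hq hAq gamma0 halpha0 s01 hx0 hstep hl.
split=> [k|]; first by split; [exact: x_neq0|exact/hstep/x_neq0].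
set v := \sum_(m < n.+1 | lambda m == lambda l) mu m *: q m.
have v0 : v != 0 := v_neq0 lambda hq hl.
have ev0 := enorm_gt0 v0.
have r0 : 0 < gamma / (gamma + lambda l) by rewrite divr_gt0// addrC.
pose xs := (gamma / (gamma + lambda l) / enorm v) *: v.
have xs0 : xs != 0 by rewrite scaler_eq0 negb_or v0 gt_eqF// divr_gt0.
have Axs : A *m xs = lambda l *: xs.
  by rewrite -scalemxAr (mulmx_v mu hAq) !scalerA mulrC.
have exs : enorm xs = gamma / (gamma + lambda l).
  by rewrite /xs enormZ gtr0_norm 1?divr_gt0// divfK// gt_eqF.
exists xs; split=> //.
- exact (iter_cvg hq hAq gamma0 halpha0 s01 hx0 hstep hl lmin).
- split=> //; first by have [] := is_diff_FA gamma hA xs0.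
  rewrite gradient_FA// Axs exs -scalerDl -scalerBl.
  rewrite [X in X *: _](_ : _ = 0) ?scale0r//.
  by field; rewrite !gt_eqF// addrC.
- by rewrite /xs (enorm_v lambda mu hq l) scalerA mul1r.
Qed.
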